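(* Fix $\mathbf p\in\mathbb{Z}^2\setminus\{\mathbf0\}$, a positive integer $N$ and $\mathbf a\in\mathcal D$ with $|\mathbf a|<|\mathbf p|$ and $\mathbf a\pm\mathbf p\in\mathcal D$, and suppose $n\ge3$ and $|\widehat{\mathbf a+k\mathbf p}|>|\mathbf p|$ for $k=1,2,\dots,n-1$. If $\lambda^\dagger=\sqrt{-\rho_1(\rho_0+\rho_2)}$ is a positive real number, then there exist real numbers $\lambda_1,\lambda_2>\lambda^\dagger$ such that $\lambda_1$ is an eigenvalue of the Galerkin class matrix $A$ and $\lambda_2$ is an eigenvalue of the Zeitlin class matrix $A'$. Similarly, if $\lambda^\dagger=\sqrt{-\rho_{n-1}(\rho_0+\rho_{n-2})}$ is a positive real number, then there exist real $\lambda_1,\lambda_2>\lambda^\dagger$ with $\lambda_1$ an eigenvalue of $A$ and $\lambda_2$ an eigenvalue of $A'$.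
   Context: $\mathcal D=[-N,N]^2\cap\mathbb{Z}^2$; for $\mathbf k\in\mathbb{Z}^2$, $\widehat{\mathbf k}$ is the unique element of $\mathcal D$ with $\mathbf k-\widehat{\mathbf k}\in(2N+1)\mathbb{Z}^2$. $n=|\{\widehat{\mathbf a+k\mathbf p}:k\in\mathbb{Z}\}|$; $\widehat{\mathbf a+k\mathbf p}$ depends only on $k$ mod $n$. $\rho_k=\frac1{|\mathbf p|^2}-\frac1{|\widehat{\mathbf a+k\mathbf p}|^2}$ for $k\in\mathbb{Z}$. Zeitlin class matrix: $A'$ is $n\times n$, indexed by $0,\dots,n-1$ mod $n$, with $(A')_{j,j+1}=\rho_{j+1}$, $(A')_{j,j-1}=-\rho_{j-1}$ (indices mod $n$), other entries zero. Galerkin class matrix: let $\{k\in\mathbb{Z}:\mathbf a+k\mathbf p\in\mathcal D\}=\{-m_1,\dots,m_2\}$; $A$ is the square matrix indexed by $-m_1,\dots,m_2$ with $A_{j,j+1}=\rho_{j+1}$, $A_{j,j-1}=-\rho_{j-1}$ and all other entries zero (no wrap-around). These are, up to a scalar factor, the linearisations restricted to one class of the Zeitlin sine truncation and of the Galerkin truncation of the 2D Euler equations on the torus about the equilibrium whose only nonzero Fourier coefficients sit at $\pm\mathbf p$. *)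

(* Defs.v *)
From HB Require Import structures.
From mathcomp Require Import all_boot all_order all_algebra.
From mathcomp Require Import reals.
Set Implicit Arguments. Unset Strict Implicit. Unset Printing Implicit Defensive.
Import Order.TTheory GRing.Theory Num.Theory.
Local Open Scope ring_scope.

Definition pt := (int * int)%type.
Definition addp (x y : pt) : pt := (x.1 + y.1, x.2 + y.2).
Definition scalep (k : int) (x : pt) : pt := (k * x.1, k * x.2).
Definition normsq (x : pt) : int := x.1 ^+ 2 + x.2 ^+ 2.

Definition inD (N : nat) (x : pt) : bool :=
  [&& - (N%:Z) <= x.1, x.1 <= N%:Z, - (N%:Z) <= x.2 & x.2 <= N%:Z].

Definition hat1 (N : nat) (z : int) : int :=
  ((z + N%:Z) %% (2 * N + 1)%:Z)%Z - N%:Z.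
(* \hat k : the unique element of D congruent to k modulo (2N+1)Z^2 *)
Definition hat (N : nat) (x : pt) : pt := (hat1 N x.1, hat1 N x.2).

Definition cls (N : nat) (a p : pt) (k : int) : pt := hat N (addp a (scalep k p)).

(* n = |{ \hat{a+kp} : k in Z }|.  Since (2N+1)p is in (2N+1)Z^2, this set
   equals { \hat{a+kp} : 0 <= k <= 2N }. *)
Definition ncls (N : nat) (a p : pt) : nat :=
  size (undup [seq cls N a p k%:Z | k <- iota 0 (2 * N + 1)]).

Definition rho (R : realType) (N : nat) (a p : pt) (k : int) : R :=
  ((normsq p)%:~R)^-1 - ((normsq (cls N a p k))%:~R)^-1.

Definition zeitlinA (R : realType) (N : nat) (a p : pt) :
    'M[R]_(ncls N a p) :=
  let n := ncls N a p in
  \matrix_(i < n, j < n)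
    if (j : nat) == (i.+1 %% n)%N then rho R N a p (i%:Z + 1)
    else if (j : nat) == ((i + n).-1 %% n)%N then - rho R N a p (i%:Z - 1)
    else 0.

(* Galerkin class matrix A, indexed by k = -m1, ..., m2; the row/column
   i : 'I_(m1+m2+1) corresponds to k = i - m1. *)
Definition galerkinA (R : realType) (N : nat) (a p : pt) (m1 m2 : nat) :
    'M[R]_(m1 + m2 + 1) :=
  \matrix_(i < m1 + m2 + 1, j < m1 + m2 + 1)
    let k := (i%:Z - m1%:Z) in
    if (j : nat) == i.+1 then rho R N a p (k + 1)
    else if (j.+1 == i) then - rho R N a p (k - 1)
    else 0.

(* Main.v *)
Require Import Defs.
From HB Require Import structures.
From mathcomp Require Import all_boot all_order all_algebra.
From mathcomp Require Import reals.
From mathcomp Require Import zify ring lra.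
Import Order.TTheory GRing.Theory Num.Theory.
Local Open Scope ring_scope.

(* Both class matrices have the form K diag(rho) with K antisymmetric, so
   det(lam - K diag(rho)) = det(D - K) * prod rho with D = lam * diag(1/rho).
   Exactly one rho is negative, and the claim follows from the intermediate
   value theorem applied to the characteristic polynomial once det(D - K) > 0
   at lam = lam^dag.  Increase the negative entry d_0 of D until it is positive:
   there D - K has positive definite symmetric part, hence positive determinant.
   If D - K became singular on the way, with entry t >= d_0 and kernel vector x,
   then t x_0^2 + sum_{j <> 0} d_j x_j^2 = 0.  But the kernel equation at index 1
   forces d_1 x_1^2 + d_2 x_2^2 >= x_0^2 / (d_1 + 1/d_2), which equals
   - d_0 x_0^2 at lam^dag, and equality of the two sides is incompatible with the
   kernel equation at index -1. *)

(** * Determinants and real eigenvalues for antisymmetric perturbations of diagonal matrices *)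

(** Along the segment the determinant is a polynomial in [s], so by the intermediate value theorem
    it cannot change sign without a root in [0, 1]. *)
Lemma det_segment_gt0 (R : rcfType) (n : nat) (P Q : 'M[R]_n) :
  (forall s, 0 <= s <= 1 -> \det (P + s *: Q) != 0) ->
  0 < \det (P + Q) -> 0 < \det P.
Proof.
move=> nz dPQ; rewrite ltNge; apply/negP => dP.
pose f := \det (map_mx polyC P + 'X *: map_mx polyC Q).
have fE s : f.[s] = \det (P + s *: Q).
  rewrite -horner_evalE -det_map_mx; congr (\det _).
  by apply/matrixP => i j; rewrite !mxE /= !horner_evalE !hornerE.
have [|s s01 /rootP fs0] := @poly_ivt R f 0 1 ler01.
  by rewrite !fE scale0r addr0 scale1r dP ltW.
by have := nz s s01; rewrite -fE fs0 eqxx.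
Qed.

Lemma antisym_quad (R : realFieldType) (n : nat) (K : 'M[R]_n) (v : 'rV[R]_n) :
  K^T = - K -> v *m K *m v^T = 0.
Proof.
move=> KT; set w := v *m K *m v^T.
have wT : w^T = - w.
  by rewrite /w !trmx_mul trmxK KT mulNmx mulmxN mulmxA.
apply/matrixP => i j; rewrite !ord1 !mxE; apply/eqP.
move/matrixP: wT => /(_ 0 0); rewrite !mxE => /eqP.
by rewrite -subr_eq0 opprK -mulr2n mulrn_eq0.
Qed.

(** Pair the kernel equation with [v] itself: the antisymmetric part drops out and only the diagonal
    form remains. *)
Lemma kernel_quad (R : realFieldType) (n : nat) (K : 'M[R]_n) (d v : 'rV[R]_n) :
  K^T = - K -> v *m (diag_mx d - K) = 0 -> \sum_j d 0 j * v 0 j ^+ 2 = 0.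
Proof.
move=> KT; rewrite mulmxBr => /(congr1 (mulmx^~ v^T)) /=.
rewrite mulmxBl (antisym_quad _ _ K) // subr0 mul0mx mul_mx_diag.
move=> /matrixP /(_ 0 0); rewrite !mxE => E; rewrite -[RHS]E; apply: eq_bigr => j _.
by rewrite !mxE mulrAC mulrC expr2.
Qed.

(** Deform linearly to the identity. Each matrix on the way is again a positive diagonal minus an
    antisymmetric matrix, so by [kernel_quad] a nonzero kernel vector would make a positive sum
    vanish. *)
Lemma det_posdiag_antisym_gt0 (R : rcfType) (n : nat) (K : 'M[R]_n) (d : 'rV[R]_n) :
  K^T = - K -> (forall j, 0 < d 0 j) -> 0 < \det (diag_mx d - K).
Proof.
move=> KT d_gt0; apply: (@det_segment_gt0 _ _ _ (1%:M - (diag_mx d - K))); last first.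
  by rewrite addrC subrK det1.
move=> s /andP[s0 s1]; apply/det0P => -[v /rV0Pn[j vj] kv].
pose e : 'rV_n := \row_j ((1 - s) * d 0 j + s).
have eE : diag_mx d - K + s *: (1%:M - (diag_mx d - K)) = diag_mx e - (1 - s) *: K.
  apply/matrixP => i k; rewrite !mxE; case: (i == k); rewrite ?mulr1n ?mulr0n; ring.
have e_gt0 k : 0 < e 0 k by rewrite mxE; have := d_gt0 k; nra.
move: kv; rewrite eE => /kernel_quad; rewrite linearZ /= KT scalerN => /(_ erefl).
rewrite (bigD1 j) //= => E.
have : 0 < e 0 j * v 0 j ^+ 2 by rewrite mulr_gt0 // exprn_even_gt0.
have : 0 <= \sum_(i < n | i != j) e 0 i * v 0 i ^+ 2.
  by apply: sumr_ge0 => i _; rewrite mulr_ge0 ?sqr_ge0 // ltW.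
by lra.
Qed.

(** The characteristic polynomial is negative at [lam] and, being monic, positive from some bound
    on, so it has a root in between. *)
Lemma eigenvalue_gt (R : rcfType) (n : nat) (A : 'M[R]_n) (lam : R) :
  \det (lam%:M - A) < 0 -> exists2 l, lam < l & eigenvalue A l.
Proof.
move=> dlt0.
have cE x : (char_poly A).[x] = \det (x%:M - A).
  rewrite -horner_evalE -det_map_mx; congr (\det _).
  apply/matrixP => i j; rewrite !mxE /= !horner_evalE !hornerE.
  by case: (i == j); rewrite ?mulr1n ?mulr0n !hornerE.
have [b bP] := monic_Cauchy_bound (char_poly_monic A).
have lmax : lam <= Num.max lam b by rewrite le_max lexx.
have [|l /andP[ll _] rl] := @poly_ivt R (char_poly A) _ _ lmax.
  by rewrite cE (ltW dlt0) ltW // bP // le_max lexx orbT.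
exists l; last by rewrite eigenvalue_root_char.
rewrite lt_neqAle ll andbT; apply: contraTneq rl => <-.
by rewrite rootE cE lt_eqF.
Qed.

(** The last hypothesis is asked of vectors satisfying every kernel equation except the one at [i0]:
    only the entry at [i0] changes during the deformation, so the other equations hold all along
    it. *)
Lemma one_negative_eigenvalue_gt (R : rcfType) (n : nat) (K : 'M[R]_n)
    (r : 'rV[R]_n) (i0 : 'I_n) (lam : R) :
  K^T = - K -> 0 < lam -> r 0 i0 < 0 -> (forall j, j != i0 -> 0 < r 0 j) ->
  (forall x : 'rV[R]_n, x 0 i0 != 0 ->
     (forall j, j != i0 -> lam / r 0 j * x 0 j = (x *m K) 0 j) ->
     - (lam / r 0 i0) * x 0 i0 ^+ 2
       < \sum_(j | j != i0) lam / r 0 j * x 0 j ^+ 2) ->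
  exists2 l, lam < l & eigenvalue (K *m diag_mx r) l.
Proof.
move=> KT lam0 r0 rj quad; apply: eigenvalue_gt.
pose d : 'rV[R]_n := \row_j (lam / r 0 j).
have d_gt0 j : j != i0 -> 0 < d 0 j by move=> ji; rewrite mxE divr_gt0 ?rj.
have d_lt0 : d 0 i0 < 0 by rewrite mxE pmulr_rlt0 // invr_lt0.
have r_neq0 j : r 0 j != 0.
  by have [->|/rj] := eqVneq j i0; [rewrite lt_eqF|move/gt_eqF ->].
have -> : lam%:M - K *m diag_mx r = (diag_mx d - K) *m diag_mx r.
  rewrite mulmxBl; congr (_ - _); apply/matrixP => i j; rewrite mul_mx_diag !mxE.
  by case: eqVneq => [->|_]; rewrite ?mulr1n ?mulr0n ?mul0r // divfK.
(* The product of the [r 0 j] has exactly one negative factor, so the goal becomes positivity of the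
   other determinant. *)
rewrite det_mulmx pmulr_rlt0.
  rewrite det_diag (bigD1 i0) //= nmulr_rlt0 //.
  by apply: prodr_gt0 => j /rj.
(* The entry at [i0] runs from its negative value at t = 0 to 1 at t = 1. *)
pose u t : 'rV[R]_n := \row_j (if j == i0 then d 0 i0 + t * (1 - d 0 i0) else d 0 j).
have uE t : diag_mx d - K + t *: ((1 - d 0 i0) *: delta_mx i0 i0) = diag_mx (u t) - K.
  apply/matrixP => i j; rewrite !mxE.
  case: (eqVneq i j) => [->|ij]; first by case: eqVneq => [->|_] /=; rewrite ?mulr1n; ring.
  have -> : (i == i0) && (j == i0) = false.
    by apply: contra_neqF ij => /andP[/eqP-> /eqP->].
  by rewrite !mulr0n; ring.
apply: (@det_segment_gt0 _ _ _ ((1 - d 0 i0) *: delta_mx i0 i0)); last first.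
  rewrite -[X in _ + X]scale1r uE; apply: det_posdiag_antisym_gt0 => // j.
  by rewrite mxE; case: eqVneq => [_|/d_gt0 //]; lra.
move=> s /andP[s0 s1]; rewrite uE; apply/det0P => -[v v0 kv].
have := kernel_quad _ _ _ _ _ KT kv; rewrite (bigD1 i0) //=.
rewrite mxE eqxx (eq_bigr (fun j => d 0 j * v 0 j ^+ 2)); last first.
  by move=> j /negPf ji; rewrite mxE ji.
move=> E.
have S0 : 0 <= \sum_(j | j != i0) d 0 j * v 0 j ^+ 2.
  by apply: sumr_ge0 => j /d_gt0 dj; rewrite mulr_ge0 ?sqr_ge0 // ltW.
(* If [v] vanishes at [i0], the remaining form is positive definite and forces v = 0. Otherwise the
   form identity bounds the remaining sum above by - d_0 v_0^2, against [quad]. *)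
have [vi0|vi0] := eqVneq (v 0 i0) 0.
  move: E; rewrite vi0 expr0n mulr0 add0r => /eqP.
  rewrite psumr_eq0 => [/allP vj|j /d_gt0 dj]; last by rewrite mulr_ge0 ?sqr_ge0 // ltW.
  case/rV0Pn: v0 => j; have [->|ji] := eqVneq j i0; first by rewrite vi0 eqxx.
  have := vj j (mem_index_enum _); rewrite ji /= mulf_eq0 sqrf_eq0.
  by rewrite gt_eqF ?d_gt0 //= => ->.
have kj j : j != i0 -> lam / r 0 j * v 0 j = (v *m K) 0 j.
  move=> ji; move: kv; rewrite mulmxBr mul_mx_diag; move: (v *m K) => y /matrixP.
  move/(_ 0 j); rewrite !mxE (negPf ji) => /eqP.
  by rewrite subr_eq0 mulrC => /eqP.
move: (quad v vi0 kj).
have -> : \sum_(j | j != i0) lam / r 0 j * v 0 j ^+ 2 =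
   \sum_(j | j != i0) d 0 j * v 0 j ^+ 2 by apply: eq_bigr => j _; rewrite mxE.
have -> : lam / r 0 i0 = d 0 i0 by rewrite mxE.
have : 0 < v 0 i0 ^+ 2 by rewrite exprn_even_gt0.
set S := \sum_(j | _) _ in E S0 *; set w := v 0 i0 ^+ 2 in E *.
move: d_lt0 E; set d0 := d 0 i0 => d_lt0 E w_gt0.
have : 0 <= s * (1 - d0) * w by apply: mulr_ge0 (ltW w_gt0); apply: mulr_ge0 => //; lra.
by lra.
Qed.

(** * The estimate along a path of three indices, and its use for a class matrix *)

(* The hypothesis on [d0] says that lam = lam^dag. *)
Lemma path_estimate_eq (R : realFieldType) (d0 d1 d2 x0 x1 x2 e : R) :
  e ^+ 2 = 1 -> 0 < d1 -> 0 < d2 -> d0 * (1 + d1 * d2) = - d2 ->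
  d1 * x1 = e * (x0 - x2) ->
  - d0 * x0 ^+ 2 <= d1 * x1 ^+ 2 + d2 * x2 ^+ 2
    ?= iff (x0 == (1 + d1 * d2) * x2).
Proof.
move=> e2 d1_gt0 d2_gt0 hd0 hx1.
have D0 : 0 < 1 + d1 * d2 by rewrite addr_gt0 // mulr_gt0.
have x1E : x1 = e * (x0 - x2) / d1 by rewrite -hx1 mulrAC mulfV ?mul1r // gt_eqF.
have d0E : d0 = - d2 / (1 + d1 * d2) by rewrite -hd0 mulfK // gt_eqF.
(* Eliminating [x1] and [d0] turns the gap between the two sides into a square over a positive
   number, which gives both the inequality and its equality case. *)
have E : d1 * x1 ^+ 2 + d2 * x2 ^+ 2 - (- d0 * x0 ^+ 2) =
    (x0 - (1 + d1 * d2) * x2) ^+ 2 / (d1 * (1 + d1 * d2)).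
  rewrite x1E d0E expr_div_n exprMn e2 mul1r; field.
  by rewrite !gt_eqF.
split; first by rewrite -subr_ge0 E divr_ge0 ?sqr_ge0 // ltW // mulr_gt0.
rewrite eq_sym -subr_eq0 E mulf_eq0 invr_eq0 sqrf_eq0 subr_eq0.
by rewrite [d1 * _ == 0]gt_eqF ?orbF // mulr_gt0.
Qed.

(* [k i] is the class index of row [i].  Congruence modulo [q = 0] is equality
   and gives the Galerkin matrix; [q = n] gives the Zeitlin matrix.  The sign [e]
   selects the half of the theorem: [e = 1] for rho_1, rho_2 and [e = -1] for
   rho_{n-1}, rho_{n-2}. *)
Lemma class_matrix_eigenvalue_gt (R : rcfType) (n : nat) (k : 'I_n -> int)
    (q e : int) (rho : int -> R) :
  e = 1 \/ e = -1 ->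
  (forall i j, (k i - k j \in dvdz q) -> i = j) ->
  (forall c c', (c - c' \in dvdz q) -> rho c = rho c') ->
  ~~ (1 \in dvdz q) -> ~~ (2 \in dvdz q) ->
  (exists i, (k i \in dvdz q)) -> (exists i, (k i - 1 \in dvdz q)) ->
  (exists i, (k i + 1 \in dvdz q)) ->
  rho 0 < 0 -> (forall i, ~~ (k i \in dvdz q) -> 0 < rho (k i)) ->
  0 < rho (2 * e) -> 0 < - rho e * (rho 0 + rho (2 * e)) ->
  exists2 l, Num.sqrt (- rho e * (rho 0 + rho (2 * e))) < l &
    eigenvalue (\matrix_(i < n, j < n)
      if (k j - (k i + 1) \in dvdz q) then rho (k i + 1)
      else if (k j - (k i - 1) \in dvdz q) then - rho (k i - 1) else 0) l.
Proof.
move=> e1 kinj rhoq q1 q2 [i0 ki0] [ip kip] [im kim] rho0 rhok rho2.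
set lam2 := - _ * _ => lam2_gt0; set lam := Num.sqrt lam2.
have lam_gt0 : 0 < lam by rewrite sqrtr_gt0.
have lamE : lam ^+ 2 = lam2 by rewrite sqr_sqrtr // ltW.
clearbody lam.
have qN c : (- c \in dvdz q) = (c \in dvdz q) by rewrite rpredN.
have qD c c' : (c - c' \in dvdz q) -> (c \in dvdz q) = (c' \in dvdz q).
  by move=> h; rewrite -[in LHS](subrK c' c) rpredDl.
have qe : ~~ (e \in dvdz q) by case: e1 => ->; rewrite ?qN.
have q2e : ~~ (2 * e \in dvdz q) by case: e1 => ->; rewrite ?mulr1 ?mulrN1 ?qN.
pose K : 'M[R]_n :=
  \matrix_(i, j) ((k j - (k i + 1) \in dvdz q)%:R - (k j - (k i - 1) \in dvdz q)%:R).
pose r : 'rV[R]_n := \row_j rho (k j).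
(* The neighbours c - 1 and c + 1 are never congruent, since [q] does not divide 2. Hence the nested
   conditional agrees with the difference of indicators in [K]. *)
have q11 c : (c - 1 \in dvdz q) -> (c + 1 \in dvdz q) -> False.
  move=> h1 h2; move: q2. have -> : 2 = (c + 1) - (c - 1) by ring.
  by rewrite rpredB.
have -> : \matrix_(i, j) (if (k j - (k i + 1) \in dvdz q) then rho (k i + 1)
      else if (k j - (k i - 1) \in dvdz q) then - rho (k i - 1) else 0) = K *m diag_mx r.
  rewrite mul_mx_diag; apply/matrixP => i j; rewrite !mxE.
  case: (boolP (k j - (k i + 1) \in dvdz q)) => h1;
    case: (boolP (k j - (k i - 1) \in dvdz q)) => h2 /=.
  - case: (q11 (k j - k i)).
      by have -> : k j - k i - 1 = k j - (k i + 1) by ring.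
    by have -> : k j - k i + 1 = k j - (k i - 1) by ring.
  - by rewrite subr0 mul1r (rhoq _ _ h1).
  - by rewrite sub0r mulN1r (rhoq _ _ h2).
  - by rewrite subr0 mul0r.
have KT : K^T = - K.
  apply/matrixP => i j; rewrite !mxE [RHS]opprB; congr (_ *+ nat_of_bool _ - _ *+ nat_of_bool _).
    by rewrite -qN; have -> : - (k i - (k j + 1)) = k j - (k i - 1) by ring.
  by rewrite -qN; have -> : - (k i - (k j - 1)) = k j - (k i + 1) by ring.
have i0P j : (k j \in dvdz q) = (j == i0).
  apply/idP/eqP => [kj|->//]; apply: kinj; exact: rpredB.
apply: (one_negative_eigenvalue_gt _ _ _ _ i0 _ KT lam_gt0).
- by rewrite mxE (rhoq _ 0) ?subr0.
- by move=> j ji; rewrite mxE rhok ?i0P.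
(* Assume the strict inequality fails. Then the path estimate is an equality and [x] is supported on
   the classes 0, e and 2e; the row at -e will contradict this. *)
move=> x xi0 row; rewrite ltNge; apply/negP => Sle.
(* [X c] is 0 at the indices [c] cut off by the Galerkin truncation. *)
pose X c := \sum_i x 0 i *+ (k i - c \in dvdz q).
have Xrep c j : (k j - c \in dvdz q) -> X c = x 0 j.
  move=> h; rewrite /X (bigD1 j) //= h big1 ?addr0 // => i ij.
  have -> // : (k i - c \in dvdz q) = false.
  apply: contra_neqF ij => h'; apply: kinj.
have -> : k i - k j = k i - c - (k j - c) by ring.
   exact: rpredB.
have Xnone c : (forall j, ~~ (k j - c \in dvdz q)) -> X c = 0.
  by move=> h; rewrite /X big1 // => j _; rewrite (negPf (h j)).
have Xq c c' : (c - c' \in dvdz q) -> X c = X c'.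
  move=> h; apply: eq_bigr => i _; congr (_ *+ _); congr nat_of_bool; apply: qD.
  by rewrite -qN; have -> : - (k i - c - (k i - c')) = c - c' by ring.
have rowX c : ~~ (c \in dvdz q) -> (exists j, (k j - c \in dvdz q)) ->
    lam / rho c * X c = X (c - 1) - X (c + 1).
  move=> c0 [j h]; have := row j; rewrite -i0P (qD _ _ h) => /(_ c0).
  rewrite mxE (rhoq _ _ h) (Xrep _ _ h) => ->; rewrite mxE.
  rewrite -sumrB; apply: eq_bigr => i _; rewrite mxE mulrBr !mulr_natr.
  congr (_ *+ nat_of_bool _ - _ *+ nat_of_bool _).
    rewrite -qN; apply: qD.
    have -> : - (k j - (k i + 1)) - (k i - (c - 1)) = - (k j - c) by ring.
    by rewrite qN.
  rewrite -qN; apply: qD.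
  have -> : - (k j - (k i - 1)) - (k i - (c + 1)) = - (k j - c) by ring.
  by rewrite qN.
pose F j := lam / r 0 j * x 0 j ^+ 2.
have F_ge0 j : j != i0 -> 0 <= F j.
  by move=> ji; rewrite mulr_ge0 ?sqr_ge0 // divr_ge0 ?(ltW lam_gt0) // mxE ltW // rhok // i0P.
(* This also covers a class cut off by the truncation, as 2e may be: the left side is then an empty
   sum and X c = 0. *)
have Fsum c : \sum_(j | (k j - c \in dvdz q)) F j = lam / rho c * X c ^+ 2.
  case: (pickP (fun j => (k j - c \in dvdz q))) => [j h|h]; last first.
    by rewrite big_pred0 // Xnone ?expr0n ?mulr0 // => j; rewrite h.
  rewrite (Xrep _ _ h) (big_pred1 j) /F ?mxE ?(rhoq _ _ h) // => i.
  apply/idP/eqP => [h'|->//]; apply: kinj.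
have -> : k i - k j = k i - c - (k j - c) by ring.
   exact: rpredB.
pose T := \sum_(j | [&& j != i0, ~~ (k j - e \in dvdz q) & ~~ (k j - 2 * e \in dvdz q)]) F j.
have SE : \sum_(j | j != i0) F j =
    lam / rho e * X e ^+ 2 + (lam / rho (2 * e) * X (2 * e) ^+ 2 + T).
  rewrite (bigID (fun j => (k j - e \in dvdz q))) /= -!Fsum; congr (_ + _).
    apply: eq_bigl => j; rewrite andb_idl // => h.
    by rewrite -i0P (qD _ _ h).
  rewrite (bigID (fun j => (k j - 2 * e \in dvdz q))) /=; congr (_ + _).
    apply: eq_bigl => j; rewrite andb_idl // => h.
    rewrite -i0P (qD _ _ h) q2e /=; apply: contra qe => h'.
    have -> : e = (k j - e) - (k j - 2 * e) by ring.
    exact: rpredB.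
  by apply: eq_bigl => j; rewrite andbA.
have X0 : X 0 = x 0 i0 by apply: Xrep; rewrite subr0.
have rep_e : exists j, (k j - e \in dvdz q).
  by case: e1 => ->; [exists ip|exists im; rewrite opprK].
have rep_Ne : exists j, (k j - - e \in dvdz q).
  by case: e1 => ->; [exists im; rewrite opprK|exists ip; rewrite opprK].
have rho_e : 0 < rho e.
  by case: rep_e => j h; rewrite -(rhoq _ _ h) rhok // (qD _ _ h).
pose ee : R := e%:~R.
have ee2 : ee ^+ 2 = 1 by rewrite /ee; case: e1 => ->; rewrite -rmorphXn.
have row_e : lam / rho e * X e = ee * (X 0 - X (2 * e)).
  rewrite rowX // /ee; case: e1 => ->.
    by rewrite mulr1z mul1r.
  rewrite mulrN1z mulN1r opprB; congr (X _ - X _); ring.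
have row_Ne : lam / rho (- e) * X (- e) = ee * (X (- (2 * e)) - X 0).
  rewrite rowX ?qN // /ee; case: e1 => ->.
    by rewrite mulr1z mul1r; congr (X _ - X _); ring.
  by rewrite mulrN1z mulN1r opprB; congr (X _ - X _); ring.
(* This is the hypothesis on [d0] in [path_estimate_eq], obtained from [lamE]. *)
have dE : lam / rho 0 * (1 + lam / rho e * (lam / rho (2 * e))) = - (lam / rho (2 * e)).
  have -> : 1 + lam / rho e * (lam / rho (2 * e)) =
     (rho e * rho (2 * e) + lam ^+ 2) / (rho e * rho (2 * e)).
    by field; rewrite !gt_eqF.
  rewrite lamE /lam2; field.
  by rewrite (gt_eqF rho2) (gt_eqF rho_e) (lt_eqF rho0).
have de_gt0 : 0 < lam / rho e by rewrite divr_gt0.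
have d2e_gt0 : 0 < lam / rho (2 * e) by rewrite divr_gt0.
have := path_estimate_eq _ _ _ _ _ _ _ _ ee2 de_gt0 d2e_gt0 dE row_e.
rewrite X0 => -[est_le est_eq].
have T_ge0 : 0 <= T by apply: sumr_ge0 => j /andP[/F_ge0].
have r0E : r 0 i0 = rho 0 by rewrite mxE (rhoq _ 0) ?subr0.
move: Sle; rewrite r0E SE addrA => Sle.
(* The estimate bounds the e and 2e terms below by the very quantity that bounds the whole sum
   above, so the remainder [T] vanishes and equality holds. *)
have T0 : T = 0.
  by apply/eqP; rewrite eq_le T_ge0 andbT -(lerD2l (- (lam / rho 0) * x 0 i0 ^+ 2)) addr0
    (le_trans _ Sle) // lerD2r.
have x0E : x 0 i0 = (1 + lam / rho e * (lam / rho (2 * e))) * X (2 * e).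
  by apply/eqP; rewrite -est_eq eq_le est_le; move: Sle; rewrite T0 addr0.
have Xother c : ~~ (c \in dvdz q) -> ~~ (c - e \in dvdz q) -> ~~ (c - 2 * e \in dvdz q) -> X c = 0.
  move=> c0 ce c2e; case: (pickP (fun j => (k j - c \in dvdz q))) => [j h|h]; last first.
    by rewrite Xnone // => j; rewrite h.
  have jP : [&& j != i0, ~~ (k j - e \in dvdz q) & ~~ (k j - 2 * e \in dvdz q)].
    have he : k j - e - (c - e) \in dvdz q.
      by have -> : k j - e - (c - e) = k j - c by ring.
    have h2e : k j - 2 * e - (c - 2 * e) \in dvdz q.
      by have -> : k j - 2 * e - (c - 2 * e) = k j - c by ring.
    by rewrite -i0P (qD _ _ h) (qD _ _ he) (qD _ _ h2e) c0 ce.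
  have : F j = 0.
    apply/eqP; rewrite eq_le F_ge0 ?andbT -?T0; last by case/andP: jP.
    rewrite /T (bigD1 j) //= lerDl; apply: sumr_ge0 => i /andP[/andP[ii _] _].
    exact: F_ge0.
  rewrite (Xrep _ _ h) => /eqP; rewrite mulf_eq0 sqrf_eq0 => /orP[|/eqP//].
  by rewrite gt_eqF // mxE (rhoq _ _ h) divr_gt0 // -(rhoq _ _ h) rhok // (qD _ _ h).
(* If [q] divides 3, then -e is congruent to 2e and -2e to e, so row -e involves only the three
   supported classes. Row e gives x1 = ee d2 x2, and substituting this in row -e leaves x0 = 0. *)
have [q3|q3] := boolP (3 \in dvdz q).
  have q3e : 3 * e \in dvdz q by rewrite dvdz_mulr.
  have h1 : - e - 2 * e \in dvdz q.
    have -> : - e - 2 * e = - (3 * e) by ring.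
    by rewrite qN.
  have h2 : - (2 * e) - e \in dvdz q.
    have -> : - (2 * e) - e = - (3 * e) by ring.
    by rewrite qN.
  move: row_Ne row_e; rewrite (rhoq _ _ h1) (Xq _ _ h1) (Xq _ _ h2) X0.
  move: (lam / rho e) (lam / rho (2 * e)) de_gt0 d2e_gt0 x0E => d1 d2 d1_gt0 d2_gt0.
  clear - ee2 xi0 d1_gt0 d2_gt0.
  move: (X e) (X (2 * e)) (x 0 i0) xi0 => x1 x2 x0 xi0 x0E row_Ne row_e.
  have x1E : x1 = ee * d2 * x2.
    apply: (mulfI (lt0r_neq0 d1_gt0)); rewrite row_e x0E; ring.
  move: row_Ne; rewrite x1E mulrBr !mulrA -expr2 ee2 mul1r => /eqP.
  rewrite eq_sym -subr_eq0 addrAC subrr add0r oppr_eq0 mulf_eq0 (negPf xi0) orbF.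
  by move/eqP => ee0; move: ee2; rewrite ee0 expr0n => /esym/eqP; rewrite oner_eq0.
have qeM c : (c * e \in dvdz q) = (c \in dvdz q).
  by case: e1 => ->; rewrite ?mulr1 // mulrN1 qN.
have X_Ne : X (- e) = 0.
  apply: Xother; first by rewrite qN.
    have -> : - e - e = - (2 * e) by ring.
    by rewrite qN.
  have -> : - e - 2 * e = - (3 * e) by ring.
  by rewrite qN qeM.
(* Outside the case of period 3, X (-e) = 0, so row -e reads X (-2e) = X 0. The class -2e lies off
   the support unless [q] divides 4, when it coincides with 2e. The first case gives X 0 = 0; the
   second gives X 0 = X (2e), against [x0E]. *)
have X_N2e : X (- (2 * e)) = 0 \/ X (- (2 * e)) = X (2 * e).
  have E4 : - (2 * e) - 2 * e = - (4 * e) by ring.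
  have [q4|q4] := boolP (4 \in dvdz q).
    by right; apply: Xq; rewrite E4 qN qeM.
  left; apply: Xother; rewrite ?E4 ?qN ?qeM //.
  have -> : - (2 * e) - e = - (3 * e) by ring.
  by rewrite qN qeM.
have ee_neq0 : ee != 0 by rewrite -sqrf_eq0 ee2 oner_eq0.
move/eqP: row_Ne; rewrite X_Ne mulr0 eq_sym mulf_eq0 (negPf ee_neq0) /= subr_eq0 X0.
case: X_N2e => -> /eqP x20; first by rewrite -x20 eqxx in xi0.
have dd_gt0 : 0 < lam / rho e * (lam / rho (2 * e)) by rewrite mulr_gt0.
move/eqP: x0E; rewrite x20 mulrDl mul1r -subr_eq0 opprD addrA subrr add0r oppr_eq0.
by rewrite mulf_eq0 (gt_eqF dd_gt0) (negPf xi0).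
Qed.

(** * Periodicity of a class and signs of [rho] *)

Lemma hat_inD N x : inD N x -> hat N x = x.
Proof.
case: x => x1 x2 /and4P[/= h1 h2 h3 h4]; rewrite /hat /hat1 /=.
by rewrite !modz_small; [congr (_, _); ring | lia | lia].
Qed.

Lemma eq_hat1 N x y : (hat1 N x == hat1 N y) = (x - y \in dvdz (2 * N + 1)%:Z).
Proof.
rewrite /hat1 (inj_eq (addIr _)) eqz_mod_dvd.
by have -> : x + N%:Z - (y + N%:Z) = x - y by ring.
Qed.

(** With L = 2N + 1, two indices give the same point iff L divides (k - l) p_1 and (k - l) p_2, that
    is, iff L / gcd(L, p_1, p_2) divides k - l. The bound on the period lets [eq_cls] find a full
    period among the indices enumerated by [ncls]. *)
Lemma cls_period N a p : exists2 n : nat, (0 < n <= 2 * N + 1)%N &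
  forall k l, (cls N a p k == cls N a p l) = (k - l \in dvdz n%:Z).
Proof.
set L := (2 * N + 1)%N; have L0 : (0 < L)%N by rewrite /L addn1.
pose g := gcdn L (gcdn `|p.1| `|p.2|)%N.
have g0 : (0 < g)%N by rewrite gcdn_gt0 L0.
have gL : (g %| L)%N by apply: dvdn_gcdl.
exists (L %/ g)%N; first by rewrite divn_gt0 // dvdn_leq //= leq_div.
move=> k l; rewrite /cls /hat xpair_eqE !eq_hat1 /= -/L.
have E b c : b + k * c - (b + l * c) = (k - l) * c by ring.
rewrite !E !dvdzE !abszM /= -dvdn_gcd -muln_gcdr.
move: `|k - l|%N => c; set G := gcdn `|p.1| `|p.2| in g g0 gL *.
have gG : (g %| G)%N by apply: dvdn_gcdr.
(* After cancelling [g], the cofactors of [L] and [G] are coprime and Gauss's lemma applies. *)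
rewrite -{1}(divnK gL) -(divnK gG) mulnA dvdn_pmul2r // Gauss_dvdl //.
by rewrite /coprime -(eqn_pmul2r g0) mul1n muln_gcdl !divnK.
Qed.

(** The indices below the period given by [cls_period] list every point of the class once, so the
    period is the cardinality [ncls]. *)
Lemma eq_cls N a p k l :
  (cls N a p k == cls N a p l) = (k - l \in dvdz (ncls N a p)%:Z).
Proof.
have [n /andP[n_gt0 nL] nP] := cls_period N a p; rewrite nP; congr (_ \in dvdz _%:Z).
rewrite /ncls -[LHS](size_iota 0) -(size_map (fun k => cls N a p k%:Z)).
apply/perm_size/uniq_perm; last 2 first.
- exact: undup_uniq.
- move=> x; rewrite mem_undup; apply/mapP/mapP => -[i]; rewrite mem_iota => /= iL ->.
    by exists i => //; rewrite mem_iota /= (leq_trans iL).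
  exists (i %% n)%N; first by rewrite mem_iota /= ltn_mod.
  apply/eqP; rewrite nP {1}(divn_eq i n) PoszD PoszM addrK.
  exact: dvdz_mull.
rewrite map_inj_in_uniq ?iota_uniq // => i j; rewrite !mem_iota /= => iL jL /eqP.
by rewrite nP -eqz_mod_dvd !modz_nat !modn_small // => /eqP[].
Qed.

Lemma normsq_gt0 x : (0 < normsq x) = (x != (0, 0)).
Proof.
case: x => x1 x2; rewrite /normsq /= lt_def addr_ge0 ?sqr_ge0 // andbT.
by rewrite paddr_eq0 ?sqr_ge0 // !sqrf_eq0 xpair_eqE.
Qed.

Lemma rho_eq (R : realType) N a p k l :
  k - l \in dvdz (ncls N a p)%:Z -> rho R N a p k = rho R N a p l.
Proof. by rewrite -eq_cls /rho => /eqP ->. Qed.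

Lemma rho_gt0 (R : realType) N a p k : p != (0, 0) ->
  normsq p < normsq (cls N a p k) -> 0 < rho R N a p k.
Proof.
rewrite -normsq_gt0 => p_gt0 pk; rewrite subr_gt0 ltf_pV2 ?posrE ?ltr0z ?ltr_int //.
exact: lt_trans pk.
Qed.

Lemma rho_lt0 (R : realType) N a p k : cls N a p k != (0, 0) ->
  normsq (cls N a p k) < normsq p -> rho R N a p k < 0.
Proof.
rewrite -normsq_gt0 => k_gt0 pk; rewrite subr_lt0 ltf_pV2 ?posrE ?ltr0z ?ltr_int //.
exact: lt_trans pk.
Qed.

(** Reducing [k] modulo the period lands in 1, ..., n - 1, where the norm hypothesis applies. *)
Lemma rho_off_period_gt0 (R : realType) N a p k :
  p != (0, 0) -> (0 < ncls N a p)%N ->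
  (forall i : nat, (1 <= i <= (ncls N a p).-1)%N ->
     normsq p < normsq (cls N a p i%:Z)) ->
  k \notin dvdz (ncls N a p)%:Z -> 0 < rho R N a p k.
Proof.
set n := ncls N a p => p0 n_gt0 big nk.
pose r := `|(k %% n%:Z)%Z|%N.
have nz_neq0 : n%:Z != 0 by rewrite eqz_nat -lt0n.
have rE : r%:Z = (k %% n%:Z)%Z by rewrite gez0_abs // modz_ge0.
have r_gt0 : (0 < r)%N.
  by rewrite lt0n -eqz_nat rE; apply: contra nk => /eqP/dvdz_mod0P.
have r_lt : (r < n)%N by rewrite -ltz_nat rE ltz_pmod // ltz_nat.
rewrite (@rho_eq R N a p k r%:Z); last by rewrite -eqz_mod_dvd rE modz_mod.
by apply: rho_gt0 => //; apply: big; rewrite r_gt0 -ltnS prednK.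
Qed.

(** * Both class matrices as instances of the congruence form *)

Lemma galerkinA_mod0 (R : realType) N a p m1 m2 :
  galerkinA R N a p m1 m2 = \matrix_(i < m1 + m2 + 1, j < m1 + m2 + 1)
    (if (j%:Z - m1%:Z) - ((i%:Z - m1%:Z) + 1) \in dvdz 0
     then rho R N a p ((i%:Z - m1%:Z) + 1)
     else if (j%:Z - m1%:Z) - ((i%:Z - m1%:Z) - 1) \in dvdz 0
     then - rho R N a p ((i%:Z - m1%:Z) - 1) else 0).
Proof.
apply/matrixP => i j; rewrite !mxE !(dvd0z, =^~ topredE) /=.
have -> : (j == i.+1 :> nat) = (j%:Z - m1%:Z - (i%:Z - m1%:Z + 1) == 0) by lia.
by have -> : (j.+1 == i :> nat) = (j%:Z - m1%:Z - (i%:Z - m1%:Z - 1) == 0) by lia.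
Qed.

Lemma zeitlinA_mod (R : realType) N a p (n := ncls N a p) :
  zeitlinA R N a p = \matrix_(i < n, j < n)
    (if j%:Z - (i%:Z + 1) \in dvdz n%:Z then rho R N a p (i%:Z + 1)
     else if j%:Z - (i%:Z - 1) \in dvdz n%:Z then - rho R N a p (i%:Z - 1) else 0).
Proof.
apply/matrixP => i j; rewrite !mxE -/n.
have E (c : nat) : (j == (c %% n)%N :> nat) = (j%:Z - c%:Z \in dvdz n%:Z).
  by rewrite -eqz_mod_dvd !modz_nat eqz_nat (modn_small (ltn_ord j)).
rewrite !E; have -> : i.+1%:Z = i%:Z + 1 by rewrite -addn1 PoszD.
(* Adding n before taking the predecessor avoids truncation at i = 0; modulo n the column is i -
   1. *)
have -> : (j%:Z - (i + n).-1%:Z \in dvdz n%:Z) = (j%:Z - (i%:Z - 1) \in dvdz n%:Z).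
  rewrite -[RHS](rpredDr _ (_ : - n%:Z \in dvdz n%:Z)) ?rpredN ?dvdzz //.
  have n_gt0 : (0 < n)%N by apply: leq_ltn_trans (ltn_ord i).
  by rewrite predn_int ?addn_gt0 ?n_gt0 ?orbT // PoszD; congr (_ \in dvdz n%:Z); ring.
by [].
Qed.

Lemma ord_shift (m1 m2 : nat) (c : int) : - (m1%:Z) <= c <= m2%:Z ->
  exists i : 'I_(m1 + m2 + 1), i%:Z - m1%:Z = c.
Proof.
move=> hc; have lt : (`|(c + m1%:Z)%R| < m1 + m2 + 1)%N by lia.
by exists (Ordinal lt) => /=; lia.
Qed.

Lemma ord_residue (n : nat) (c : int) : (0 < n)%N ->
  exists i : 'I_n, i%:Z - c \in dvdz n%:Z.
Proof.
move=> n_gt0; have nz_neq0 : n%:Z != 0 by rewrite eqz_nat -lt0n.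
have c0 : 0 <= (c %% n%:Z)%Z by rewrite modz_ge0.
have lt : (`|(c %% n%:Z)%Z| < n)%N by rewrite -ltz_nat gez0_abs // ltz_pmod // ltz_nat.
by exists (Ordinal lt) => /=; rewrite gez0_abs // -eqz_mod_dvd modz_mod.
Qed.

Lemma notin_dvdz_small (n c : nat) : (0 < c < n)%N -> c%:Z \notin dvdz n%:Z.
Proof. by case/andP=> c0 cn; rewrite -[_ \in _]/(n %| c)%N gtnNdvd. Qed.

(** On D the reduction [hat] is the identity, so distinct points of the line inside D stay distinct
    modulo the lattice. This makes [rho] positive at every nonzero Galerkin index, negative ones
    included. *)
Lemma galerkin_offset_notin_period N a p k : p != (0, 0) -> inD N a ->
  inD N (addp a (scalep k p)) -> k != 0 -> k \notin dvdz (ncls N a p)%:Z.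
Proof.
move=> p0 aD kD; apply: contra => nk.
have : cls N a p k == cls N a p 0 by rewrite eq_cls subr0.
have -> : cls N a p 0 = a.
  by rewrite /cls /scalep !mul0r /addp !addr0 -surjective_pairing hat_inD.
rewrite /cls hat_inD // [X in _ == X]surjective_pairing /addp /scalep xpair_eqE /=.
have E (b x : int) : (b + x == b) = (x == 0) by rewrite -subr_eq0 addrAC subrr add0r.
rewrite !E !mulf_eq0; case: eqP => //= _ /andP[/eqP u0 /eqP v0].
by rewrite [p]surjective_pairing u0 v0 eqxx in p0.
Qed.

(** * Assembly of the two truncations and the two halves *)

Lemma class_eigenvalues_gt (R : realType) (N : nat) (p a : pt) (m1 m2 : nat) (e : int) :
  e = 1 \/ e = -1 ->
  p != (0, 0) ->
  inD N a ->
  normsq a < normsq p ->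
  inD N (addp a p) ->
  inD N (addp a (scalep (-1) p)) ->
  (3 <= ncls N a p)%N ->
  (forall k : nat, (1 <= k <= (ncls N a p).-1)%N ->
     normsq p < normsq (cls N a p k%:Z)) ->
  (forall k : int, inD N (addp a (scalep k p)) = (- (m1%:Z) <= k <= m2%:Z)) ->
  let lam2 := - rho R N a p e * (rho R N a p 0 + rho R N a p (2 * e)) in
  0 < lam2 ->
  exists l1 l2 : R, [/\ Num.sqrt lam2 < l1, Num.sqrt lam2 < l2,
     eigenvalue (galerkinA R N a p m1 m2) l1 &
     eigenvalue (zeitlinA R N a p) l2].
Proof.
move=> e1 p0 aD ap apD amD n3 big gal lam2 lam2_gt0.
set n := ncls N a p in n3 big *.
have n_gt0 : (0 < n)%N by apply: leq_trans n3.
have p1E : addp a (scalep 1 p) = addp a p by rewrite /scalep /addp !mul1r.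
have cls0 : cls N a p 0 = a.
  by rewrite /cls /scalep !mul0r /addp !addr0 -surjective_pairing hat_inD.
have cls1 : cls N a p 1 = addp a p by rewrite /cls p1E hat_inD.
have range1 : - (m1%:Z) <= 1 <= m2%:Z by rewrite -gal p1E.
have rangeN1 : - (m1%:Z) <= -1 <= m2%:Z by rewrite -gal.
have range0 : - (m1%:Z) <= 0 <= m2%:Z by rewrite oppr_le0.
(* The inverse of 0 is 0 here, so a = 0 would make [rho] positive at 0. It is excluded because a + p
   would then have the norm of p, against the hypothesis at k = 1. *)
have a0 : a != (0, 0).
  apply/eqP => a0; have n1 : (0 < n.-1)%N by rewrite -ltnS prednK // ltnW.
  by have := big 1%N n1; rewrite cls1 a0 /addp !add0r -surjective_pairing ltxx.
have rho0 : rho R N a p 0 < 0 by apply: rho_lt0; rewrite cls0.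
have rho_pos k : k \notin dvdz n%:Z -> 0 < rho R N a p k by exact: rho_off_period_gt0.
have n1 : 1 \notin dvdz n%:Z by apply: (@notin_dvdz_small n 1); rewrite (leq_trans _ n3).
have n2 : 2 \notin dvdz n%:Z by apply: (@notin_dvdz_small n 2).
(* Periodicity gives the sign even when the point a + 2ep lies outside D. *)
have rho2e : 0 < rho R N a p (2 * e).
  by apply: rho_pos; case: e1 => ->; rewrite ?mulr1 // mulrN1 rpredN.
have dvd0 c : (c \in dvdz 0) = (c == 0) by exact: dvd0z.
have [l1 l1_gt l1E] : exists2 l, Num.sqrt lam2 < l & eigenvalue (galerkinA R N a p m1 m2) l.
  rewrite galerkinA_mod0.
  apply: (class_matrix_eigenvalue_gt _ _ (fun i => i%:Z - m1%:Z)) => //.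
  - move=> i j; rewrite dvd0 opprB addrA subrK subr_eq0 => /eqP[].
    exact: val_inj.
  - by move=> c c'; rewrite dvd0 subr_eq0 => /eqP ->.
  - by have [i iE] := ord_shift m1 m2 0 range0; exists i; rewrite dvd0 iE.
  - by have [i iE] := ord_shift m1 m2 1 range1; exists i; rewrite dvd0 iE.
  - by have [i iE] := ord_shift m1 m2 (-1) rangeN1; exists i; rewrite dvd0 iE.
  move=> i; rewrite dvd0 => k0; apply/rho_pos/galerkin_offset_notin_period => //.
  have := ltn_ord i; rewrite {2}addn1 ltnS => im.
  by rewrite gal lerBrDl subrr lerBlDl -PoszD !lez_nat im.
have [l2 l2_gt l2E] : exists2 l, Num.sqrt lam2 < l & eigenvalue (zeitlinA R N a p) l.
  rewrite zeitlinA_mod.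
  apply: (class_matrix_eigenvalue_gt _ _ (fun i => i%:Z)) => //.
  - move=> i j; rewrite -eqz_mod_dvd !modz_nat !modn_small // => /eqP[].
    exact: val_inj.
  - by move=> c c'; apply: rho_eq.
  - by have [i iE] := ord_residue n 0 n_gt0; exists i; rewrite -[i%:Z]subr0.
  - exact: ord_residue.
  - by have [i iE] := ord_residue n (-1) n_gt0; exists i; rewrite -[1]opprK.
  by move=> i; apply: rho_pos.
by exists l1, l2; split.
Qed.

Theorem theorem2 (R : realType) (N : nat) (p a : pt) (m1 m2 : nat) :
  p != (0, 0) ->
  (0 < N)%N ->
  inD N a ->
  normsq a < normsq p ->
  inD N (addp a p) ->
  inD N (addp a (scalep (-1) p)) ->
  (3 <= ncls N a p)%N ->
  (forall k : nat, (1 <= k <= (ncls N a p).-1)%N ->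
     normsq p < normsq (cls N a p k%:Z)) ->
  (* {k in Z : a + k p in D} = {-m1, ..., m2} *)
  (forall k : int, inD N (addp a (scalep k p)) = (- (m1%:Z) <= k <= m2%:Z)) ->
  (0 < - rho R N a p 1 * (rho R N a p 0 + rho R N a p 2) ->
     let ldag := Num.sqrt (- rho R N a p 1 * (rho R N a p 0 + rho R N a p 2)) in
     exists l1 l2 : R, [/\ ldag < l1, ldag < l2,
        eigenvalue (galerkinA R N a p m1 m2) l1 &
        eigenvalue (zeitlinA R N a p) l2]) /\
  (let n := ncls N a p in
   0 < - rho R N a p (n%:Z - 1) * (rho R N a p 0 + rho R N a p (n%:Z - 2)) ->
     let ldag := Num.sqrt (- rho R N a p (n%:Z - 1) *
                            (rho R N a p 0 + rho R N a p (n%:Z - 2))) in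
     exists l1 l2 : R, [/\ ldag < l1, ldag < l2,
        eigenvalue (galerkinA R N a p m1 m2) l1 &
        eigenvalue (zeitlinA R N a p) l2]).
Proof.
move=> p0 _ aD ap apD amD n3 big gal; split.
  exact: (class_eigenvalues_gt R N p a m1 m2 1 (or_introl erefl)).
(* By periodicity the indices n - 1 and n - 2 act as -1 and -2, which is the case e = -1. *)
move=> n; have rhoN c : rho R N a p (n%:Z - c) = rho R N a p (- c).
  by apply: rho_eq; rewrite opprK subrK dvdzz.
rewrite !rhoN.
exact: (class_eigenvalues_gt R N p a m1 m2 (-1) (or_intror erefl)).
Qed.
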